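(* Let $X$ be a finite set with at least three elements. Two combinatorial trees $T$ and $T'$ marked by $X$ are isomorphic if and only if $\psi(T)=\psi(T')$. If $T$ is a combinatorial tree marked by $X$, then $\psi(T)$ is an admissible collection of partitions of $X$, and every admissible collection of partitions of $X$ is the image under $\psi$ of a (stable) combinatorial tree marked by $X$.
   Context: A combinatorial tree marked by $X$ is a finite tree $T$, the disjoint union of its set of vertices and its set of edges, whose set of leaves (external vertices) is $X$ and all of whose internal vertices have valence at least $3$ (stability). A tree map between combinatorial trees maps internal vertices to internal vertices, leaves to leaves, edges to edges, and adjacent vertices to adjacent vertices. An isomorphism between two combinatorial trees marked by $X$ is a bijective tree map restricting to the identity on $X$. For an internal vertex $v$ of $T$ and an edge $e$ adjacent to $v$, $B_v(e)$ is the connected component of $T\setminus\{v\}$ containing $e$. The set $P_v=\{B_v(e)\cap X : e \text{ edge adjacent to } v\}$ is a partition of $X$, and $\psi(T)=\{P_v : v\text{ internal vertex of }T\}$. By convention, a partition does not contain the element $\emptyset$. A collection $\mathcal P$ of partitions of $X$ is admissible if: (1) every partition $P\in\mathcal P$ contains at least three distinct elements; (2) for every $P\in\mathcal P$ and every $B\in P$, either there exists a partition $P'\in\mathcal P$ containing $X-B$ as an element, or $B=\{x\}$ with $x\in X$; (3) if $P_1,P_2\in\mathcal P$ are two distinct partitions, then $P_1\cap P_2=\emptyset$.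
   Formalization: Admissible collections are required to be nonempty: the empty collection satisfies conditions (1)–(3) vacuously but is not ψ(T) for any tree T marked by X when X has at least three elements. *)

(* Defs.v *)
From mathcomp Require Import all_boot.

Set Implicit Arguments.
Unset Strict Implicit.
Unset Printing Implicit Defensive.

Section Graph.
Variables (V : finType) (E : {set {set V}}).

Definition adj : rel V := [rel v w | [set v; w] \in E].

Definition valence (v : V) : nat := #|[set e in E | v \in e]|.

(* Since [adj] is symmetric, [:: v; w] is a simple cycle in the sense of
   [ucycle] as soon as v and w are adjacent, hence the bound 2. *)
Definition is_tree : Prop :=
  [/\ forall e, e \in E -> #|e| = 2,
      forall v w, connect adj v w
    & forall c : seq V, ucycle adj c -> size c <= 2].

Definition leaves : {set V} := [set v | valence v == 1].

Definition internal : {set V} := ~: leaves.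

End Graph.

(* The vertex set is X + nonleaf, so that X is literally a set of vertices;
   [leaves_mtree] says that it is the set of vertices of valence 1. *)
Record mtree (X : finType) := MTree {
  nonleaf : finType;
  edges : {set {set (X + nonleaf)}};
  is_tree_mtree : is_tree edges;
  leaves_mtree : leaves edges = [set inl x | x : X];
  stable_mtree : forall v, v \in internal edges -> 3 <= valence edges v
}.

Section Psi.
Variables (X : finType) (T : mtree X).

Definition vertex : finType := (X + nonleaf T)%type.

Definition edge : finType := {e : {set vertex} | e \in edges T}.

(* T itself, as the disjoint union of its vertices and its edges. *)
Definition elt : finType := (vertex + edge)%type.

Definition incident (a b : elt) : bool :=
  match a, b with
  | inl v, inr e | inr e, inl v => v \in val e
  | _, _ => false
  end.

(* B_v(e). An edge e adjacent to v is still an element of T \ {v}. *)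
Definition branch (v : vertex) (e : edge) : {set elt} :=
  [set z | connect [rel a b | [&& a != inl v, b != inl v & incident a b]]
                   (inr e) z].

Definition marks (B : {set elt}) : {set X} := [set x | inl (inl x) \in B].

Definition vpart (v : vertex) : {set {set X}} :=
  [set marks (branch v e) | e : edge & v \in val e].

Definition psi : {set {set {set X}}} :=
  [set vpart v | v in internal (edges T)].

End Psi.

Section Isomorphism.
Variables (X : finType) (T T' : mtree X).

(* Nothing relates the image of an edge to the images of its endpoints. For a
   bijective tree map f this loses nothing: {v, w} |-> {f v, f w} is then an
   injection between edge sets of the same cardinality, so f can be replaced by
   the map that agrees with it on vertices and is this bijection on edges. *)
Definition tree_map (f : elt T -> elt T') : Prop :=
  [/\ forall v, v \in internal (edges T) ->
        exists2 v', v' \in internal (edges T') & f (inl v) = inl v',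
      forall v, v \in leaves (edges T) ->
        exists2 v', v' \in leaves (edges T') & f (inl v) = inl v',
      forall e, exists e', f (inr e) = inr e'
    & forall v w, adj (edges T) v w ->
        exists v' w', [/\ f (inl v) = inl v', f (inl w) = inl w'
                        & adj (edges T') v' w']].

Definition isomorphic : Prop :=
  exists f : elt T -> elt T',
    [/\ tree_map f, bijective f
      & forall x : X, f (inl (inl x)) = inl (inl x)].

End Isomorphism.

(* Collections are nonempty: the empty one would satisfy the other conditions
   vacuously, but it is not of the form [psi T] once X has three elements. *)
Definition admissible (X : finType) (C : {set {set {set X}}}) : Prop :=
  [/\ C != set0,
      forall P, P \in C -> partition P [set: X],
      forall P, P \in C -> 3 <= #|P|,
      forall P B, P \in C -> B \in P ->
        (exists2 P', P' \in C & ~: B \in P') \/ (exists x, B = [set x])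
    & forall P1 P2, P1 \in C -> P2 \in C -> P1 != P2 -> P1 :&: P2 = set0].

(* Main.v *)
Require Import Defs.
From mathcomp Require Import all_boot.

Set Implicit Arguments.
Unset Strict Implicit.
Unset Printing Implicit Defensive.

(** Everything about a tree [T] is read off its sides: for adjacent vertices [v]
    and [w], [side v w] is the component of [w] once [v] is removed. In a tree,
    the two sides of an edge are complementary ([sideC]), and the sides at [v]
    partition the vertices other than [v] ([side_exists], [side_unique]). The
    blocks of the partition at [v] are the sets of marks on the sides at [v].

    By stability every side carries a mark ([side_marks_neq0]), and a block
    determines the vertex and the edge that cut it out ([side_marks_eq]).
    Together with the complementarity of sides this gives admissibility. It also
    shows that [psi T] determines [T]: its elements are the internal vertices,
    and two vertices are adjacent exactly when their partitions have opposite
    blocks ([adjP]), where a leaf [x] counts as a vertex whose only block is the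
    complement of [x]. So a bijection between the vertices of two trees that
    respects partitions is an isomorphism ([psi_isomorphic]); conversely an
    isomorphism carries sides to sides ([adj_morphism_vpart]).

    Given an admissible collection [C], this recipe is applied backwards: the
    vertices are the marks and the partitions in [C], and two of them are linked
    when they have opposite blocks. Root the graph at a mark [x0]. Since an
    opposite of a block belongs to exactly one vertex, each vertex other than [x0]
    has exactly one link that leads through its block containing [x0], and along
    this link the block containing [x0] shrinks ([rank_lt]). All the other links
    go up in rank, so the graph is connected and acyclic ([links_tree]). That no
    part of [C] is left disconnected from the rest comes from the same descent:
    it always ends at the leaf [x0]. Descending instead towards each mark of a
    block shows that the block is contained in the corresponding side, and
    comparing partitions gives equality ([vpart_realization]). *)

(** * Components of a tree with a vertex removed *)

Lemma connect_closed_ind (V : finType) (r : rel V) (P : V -> Prop) x y :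
  P x -> (forall a b, P a -> r a b -> P b) -> connect r x y -> P y.
Proof.
move=> Px stepP /connectP[p]; elim: p x Px => [|a p IHp] x Px /=; first by move=> _ ->.
by case/andP=> rxa; apply: IHp; apply: stepP rxa.
Qed.

Section Sides.
Variables (V : finType) (E : {set {set V}}).

Definition avoiding v : rel V := [rel a b | [&& a != v, b != v & adj E a b]].

Definition side v w : {set V} := [set u | connect (avoiding v) w u].

Definition neighbors v : {set V} := [set w | adj E v w].

Lemma adj_sym : symmetric (adj E).
Proof. by move=> v w; rewrite /adj /= setUC. Qed.

Lemma avoiding_sym v : connect_sym (avoiding v).
Proof.
by apply: sym_connect_sym => a b; rewrite /avoiding /= adj_sym andbCA.
Qed.

Lemma side_refl v w : w \in side v w.
Proof. by rewrite inE. Qed.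

Lemma side_step v w a b :
  a \in side v w -> a != v -> adj E a b -> b != v -> b \in side v w.
Proof.
rewrite !inE => wa av ab bv; apply: connect_trans wa (connect1 _).
by rewrite /avoiding /= av bv ab.
Qed.

Lemma side_notin v w : w != v -> v \notin side v w.
Proof.
move=> wv; rewrite inE; apply/negP => wv'.
suff: v != v by rewrite eqxx.
by apply: (connect_closed_ind (P := fun z => z != v) _ _ wv') => // a b _ /and3P[].
Qed.

Section Tree.
Hypothesis treeE : is_tree E.

Lemma adj_neq v w : adj E v w -> v != w.
Proof.
case: treeE => card_edge _ _ /card_edge; rewrite cards2.
by case: (v == w).
Qed.

Lemma edge_other e v : e \in E -> v \in e -> exists w, e = [set v; w].
Proof.
case: treeE => card_edge _ _ /card_edge card_e ve.
have /cards1P[w ew] : #|e :\ v| == 1.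
  by have := cardsD1 v e; rewrite card_e ve add1n => -[<-].
by exists w; rewrite -ew setD1K.
Qed.

Lemma set2_inj v : injective (fun w : V => [set v; w]).
Proof.
move=> w w' /= eq_ww'; have: w \in [set v; w'] by rewrite -eq_ww' set22.
rewrite !inE => /orP[/eqP wv|/eqP //].
have: w' \in [set v; w] by rewrite eq_ww' set22.
by rewrite wv setUid inE => /eqP.
Qed.

Lemma valence_neighbors v : valence E v = #|neighbors v|.
Proof.
rewrite -(card_imset _ (@set2_inj v)); apply: eq_card => e; rewrite inE.
apply/andP/imsetP => [[Ee ve]|[w]].
  by have [w e_vw] := edge_other Ee ve; exists w; rewrite // inE /adj /= -e_vw.
by rewrite inE => vw ->; rewrite set21.
Qed.

(** A path joining two neighbours of [v] off [v] closes up to a cycle through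
    [v]. The other properties of sides use acyclicity only through this one. *)
Lemma side_neighbor_eq v w u :
  adj E v w -> adj E v u -> u \in side v w -> u = w.
Proof.
move=> vw vu; rewrite inE => /connectP[p0 w_p0 last_p0].
case/shortenP: w_p0 last_p0 => p w_p uniq_p _ last_p.
have [_ _ acyclic] := treeE.
have p_v : v \notin p.
  elim: p {uniq_p last_p vw}w w_p => //= a p IHp w /andP[/and3P[_ av _] a_p].
  by rewrite inE negb_or eq_sym av (IHp a).
have /acyclic : ucycle (adj E) [:: v, w & p].
  rewrite /ucycle [uniq _]/= inE negb_or adj_neq // p_v -/(uniq (w :: p)) uniq_p andbT.
  rewrite /= vw rcons_path -last_p adj_sym vu /= !andbT.
  by apply: sub_path w_p => a b /and3P[].
by case: p {w_p uniq_p p_v} last_p.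
Qed.

Lemma side_unique v w w' u :
  adj E v w -> adj E v w' -> u \in side v w -> u \in side v w' -> w = w'.
Proof.
move=> vw vw'; rewrite !inE => wu w'u; apply: (side_neighbor_eq vw' vw).
by rewrite inE; apply: connect_trans w'u _; rewrite avoiding_sym.
Qed.

Lemma side_exists v u : u != v -> exists2 w, adj E v w & u \in side v w.
Proof.
have [_ conn _] := treeE; move=> uv.
suff [u_v|//] : u = v \/ exists2 w, adj E v w & u \in side v w.
  by rewrite u_v eqxx in uv.
apply: (connect_closed_ind
          (P := fun z => z = v \/ exists2 w, adj E v w & z \in side v w)
          _ _ (conn v u)); first by left.
move=> a b [-> vb|[w vw wa] ab]; first by right; exists b; rewrite ?side_refl.
have [->|bv] := eqVneq b v; [by left | right; exists w => //].
apply: (side_step wa _ ab bv); apply: contraTneq wa => ->.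
by rewrite side_notin // eq_sym adj_neq.
Qed.

(** This is the fact that removing the edge between [v] and [w] leaves exactly
    two components. A path from [v] off [w] could enter [side v w] only by a
    second neighbour of [v] lying in that side. *)
Lemma sideC v w : adj E v w -> side w v = ~: side v w.
Proof.
move=> vw; have [_ conn _] := treeE; have v_w := adj_neq vw.
apply/setP => u; rewrite in_setC; apply/idP/idP => [|notu].
  rewrite inE; apply: (connect_closed_ind (P := fun z => z \notin side v w)).
    by rewrite side_notin // eq_sym.
  move=> a b na /and3P[aw bw ab]; apply: contra na => wb.
  have bv : b != v by apply: contraTneq wb => ->; rewrite side_notin // eq_sym.
  have [av|av] := eqVneq a v.
    by rewrite av in ab; rewrite (side_neighbor_eq vw ab wb) eqxx in bw.
  by apply: (side_step wb bv _ av); rewrite adj_sym.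
suff [//|wu] : u \in side w v \/ u \in side v w by rewrite wu in notu.
apply: (connect_closed_ind (P := fun z => z \in side w v \/ z \in side v w)
          _ _ (conn v u)); first by left; apply: side_refl.
move=> a b [va|wa] ab.
  have [->|bw] := eqVneq b w; first by right; apply: side_refl.
  left; apply: (side_step va _ ab bw); apply: contraTneq va => ->.
  by rewrite side_notin.
have [->|bv] := eqVneq b v; first by left; apply: side_refl.
right; apply: (side_step wa _ ab bv); apply: contraTneq wa => ->.
by rewrite side_notin // eq_sym.
Qed.

(** Leaving [side w t] along a path is possible only through [w]. *)
Lemma side_sub v u w t :
  adj E w t -> u \in side w t -> w \notin side v u -> side v u \subset side w t.
Proof.
move=> wt tu wNu; apply/subsetP => z; rewrite inE => uz.
suff [] : z \in side w t /\ z \in side v u by [].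
apply: (connect_closed_ind (P := fun z => z \in side w t /\ z \in side v u)
          _ _ uz); first by rewrite side_refl.
move=> a b [ta ua] /and3P[av bv ab].
have ub : b \in side v u by apply: (side_step ua av ab bv).
by split=> //; apply: (side_step ta _ ab _);
  [apply: contraNneq wNu => <- | apply: contraNneq wNu => <-].
Qed.

Lemma side_nested_branch v u w t :
  adj E v u -> adj E w t -> w \notin side v u -> v \in side w t ->
  side v u \subset side w t.
Proof.
move=> vu wt uNw tv; apply: side_sub => //.
apply: (side_step tv _ vu _); last by apply: contraNneq uNw => <-; apply: side_refl.
by apply: contraTneq tv => ->; rewrite side_notin // eq_sym adj_neq.
Qed.

Lemma side_nested v w u :
  adj E v w -> adj E w u -> u != v -> side w u \subset side v w.
Proof.
move=> vw wu uv; apply: side_nested_branch (side_refl _ _) => //.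
apply: contraNN uv => vNu; have wv : adj E w v by rewrite adj_sym.
by rewrite (side_unique wu wv vNu (side_refl _ _)).
Qed.

End Tree.
End Sides.

(** * The partition at a vertex *)

Section Partitions.
Variables (X : finType) (T : mtree X).
Implicit Types (v w u : vertex T) (x : X).

Let E : {set {set vertex T}} := edges T.
Let treeE : is_tree E := is_tree_mtree T.

Definition side_marks v w : {set X} := [set x | inl x \in side E v w].

Lemma mem_side_marks v w x : (x \in side_marks v w) = (inl x \in side E v w).
Proof. by rewrite in_set. Qed.

(** A walk in the space of vertices and edges alternates between the two kinds, so
    it is a walk of vertices with the traversed edges inserted. *)
Lemma marks_branch v w (e : edge T) :
  val e = [set v; w] -> marks (branch v e) = side_marks v w.
Proof.
move=> e_vw; have vw : adj E v w by rewrite /adj /= -e_vw (valP e).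
have v_w := adj_neq treeE vw.
apply/setP => x; rewrite !inE; apply/idP/idP.
  (* An edge is reached when all its endpoints other than [v] are. *)
  pose P (z : elt T) : Prop := match z with
    | inl u => u \in side E v w
    | inr e' => forall u, u \in val e' -> u != v -> u \in side E v w
    end.
  move=> e_x; suff: P (inl (inl x)) by rewrite /P inE.
  apply: connect_closed_ind e_x.
    by move=> u; rewrite e_vw !inE => /orP[]/eqP-> //; rewrite ?eqxx ?connect0.
  case=> [a|a] [b|b] wa /and3P[av bv] //= ab.
    move=> u ub uv; have [u' b_uu'] := edge_other treeE (valP b) ab.
    move: ub; rewrite b_uu' in_set2 => /orP[/eqP u_a|/eqP u_u'].
      by move: wa; rewrite -u_a.
    apply: (side_step wa _ _ uv); first by apply: contraNneq av => ->.
    by rewrite /adj /= u_u' -b_uu' (valP b).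
  by apply: wa => //; apply: contraNneq bv => ->.
move=> w_x; pose r := [rel a b : elt T | [&& a != inl v, b != inl v & incident a b]].
suff: connect r (inr e) (inl (inl x)) by [].
apply: (connect_closed_ind (P := fun u => connect r (inr e) (inl u)) _ _ w_x).
  by apply: connect1; rewrite /= e_vw set22 andbT; apply: contraNneq v_w => -[->].
move=> a b e_a /and3P[av bv ab]; apply: connect_trans e_a _.
pose e' : edge T := exist _ [set a; b] ab.
apply: (@connect_trans _ _ (inr e')); apply: connect1; rewrite /= ?set21 ?set22 andbT.
  by apply: contraNneq av => -[->].
by apply: contraNneq bv => -[->].
Qed.

Lemma vpartE v : vpart v = [set side_marks v w | w in neighbors E v].
Proof.
apply/setP => B; apply/imsetP/imsetP => -[].
  move=> e; rewrite inE => ve ->; have [w e_vw] := edge_other treeE (valP e) ve.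
  exists w; last exact: marks_branch.
  by rewrite inE /adj /= -e_vw (valP e).
move=> w; rewrite inE => vw ->; exists (exist _ [set v; w] vw).
  by rewrite inE /= set21.
by rewrite (@marks_branch v w).
Qed.

Lemma mem_vpart v w : adj E v w -> side_marks v w \in vpart v.
Proof. by move=> vw; rewrite vpartE imset_f // inE. Qed.

Lemma side_marksC v w : adj E v w -> side_marks w v = ~: side_marks v w.
Proof.
by move=> vw; apply/setP => x; rewrite in_setC !mem_side_marks sideC // in_setC.
Qed.

Lemma side_marksS v u w t :
  side E v u \subset side E w t -> side_marks v u \subset side_marks w t.
Proof. by move=> /subsetP sub; apply/subsetP => x; rewrite !mem_side_marks => /sub. Qed.

Lemma valence_leaf x : valence E (inl x) = 1.
Proof.
have: inl x \in leaves E by rewrite leaves_mtree imset_f.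
by rewrite inE => /eqP.
Qed.

Lemma internalE v : (v \in internal E) = if v is inr _ then true else false.
Proof.
rewrite inE leaves_mtree; case: v => [x|i]; first by rewrite imset_f.
by apply/imsetP => -[].
Qed.

Lemma leaf_neighbors x w w' : adj E (inl x) w -> adj E (inl x) w' -> w = w'.
Proof.
move=> xw xw'; have := valence_leaf x.
rewrite (valence_neighbors treeE) => /eqP/cards1P[u nb].
have: w \in neighbors E (inl x) by rewrite inE.
have: w' \in neighbors E (inl x) by rewrite inE.
by rewrite nb !inE => /eqP-> /eqP->.
Qed.

Lemma internal_third (i : nonleaf T) u u' :
  exists2 w, adj E (inr i) w & (w != u) && (w != u').
Proof.
have := stable_mtree (v := inr i).
rewrite internalE (valence_neighbors treeE) => /(_ isT) ge3.
have /subsetPn[w] : ~~ (neighbors E (inr i) \subset [set u; u']).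
  apply: contraL ge3 => /subset_leq_card le_nb; rewrite -ltnNge ltnS.
  by apply: leq_trans le_nb _; rewrite cards2; case: (u == u').
by rewrite !inE negb_or => vw ww'; exists w.
Qed.

(** Walking away from [v] through [w] never gets stuck before a leaf, since an
    internal vertex always has a further branch, which is strictly smaller. *)
Lemma side_marks_neq0 v w : adj E v w -> side_marks v w != set0.
Proof.
have [n] := ubnP #|side E v w|; elim: n v w => // n IHn v w; rewrite ltnS => le_n vw.
case: w => [x|i] in vw le_n *.
  by apply/set0Pn; exists x; rewrite mem_side_marks side_refl.
have [u iu /andP[uv _]] := internal_third i v v.
have sub := side_nested treeE vw iu uv.
have /set0Pn[x xu] : side_marks (inr i) u != set0.
  apply: (IHn _ _ _ iu); apply: leq_trans le_n; apply: proper_card; rewrite properE sub.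
  apply/subsetPn; exists (inr i); rewrite ?side_refl //.
  by rewrite side_notin // eq_sym (adj_neq treeE iu).
by apply/set0Pn; exists x; apply: (subsetP (side_marksS sub)).
Qed.

Lemma side_marks_inj v : {in neighbors E v &, injective (side_marks v)}.
Proof.
move=> w w'; rewrite !inE => vw vw' eq_ww'.
have /set0Pn[x wx] := side_marks_neq0 vw; have w'x := wx; rewrite eq_ww' in w'x.
by rewrite !mem_side_marks in wx w'x; apply: (side_unique treeE vw vw' wx w'x).
Qed.

Lemma card_vpart v : #|vpart v| = valence E v.
Proof.
by rewrite vpartE (card_in_imset (@side_marks_inj v)) (valence_neighbors treeE).
Qed.

Lemma side_marks_leaf x w : adj E (inl x) w -> side_marks (inl x) w = ~: [set x].
Proof.
move=> xw; apply/setP => y; rewrite mem_side_marks in_setC in_set1.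
have [->|yx] := eqVneq y x.
  by apply/negbTE; rewrite side_notin // eq_sym (adj_neq treeE xw).
have [|u xu yu] := side_exists treeE (v := inl x) (u := inl y).
  by apply: contraNneq yx => -[->].
by rewrite (leaf_neighbors xw xu).
Qed.

Lemma internal_partition (i : nonleaf T) : partition (vpart (inr i)) [set: X].
Proof.
rewrite /partition; apply/and3P; split.
- rewrite eqEsubset subsetT; apply/subsetP => x _; apply/bigcupP.
  have [|w iw wx] := side_exists treeE (v := inr i) (u := inl x); first by [].
  by exists (side_marks (inr i) w); rewrite ?mem_vpart // mem_side_marks.
- apply/trivIsetP => A B; rewrite vpartE => /imsetP[w + ->] /imsetP[w' + ->].
  rewrite !inE => iw iw'; apply: contraR => /pred0Pn[x /andP[wx w'x]].
  rewrite /= !mem_side_marks in wx w'x.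
  by rewrite (side_unique treeE iw iw' wx w'x).
- rewrite vpartE; apply/imsetP => -[w]; rewrite inE => /side_marks_neq0 + eq0.
  by rewrite -eq0 eqxx.
Qed.

(** A block remembers the directed edge that cuts it out. Suppose that the sides
    of [{v,u}] at [v] and of [{w,t}] at [w] carry the same marks, with [v] and [w]
    distinct.
    - If both sides contain the other vertex, they cover the tree; the marks of
      [side t w], the complement of [side w t], lie in [side v u] but not
      in [side w t].
    - If only one does, say [side v u] contains [w], then it contains every
      branch at [w] except the one towards [v]; one of these is not [side w t]
      and has marks of its own, unless [w] is itself a mark that is not in
      [side w t].
    - If none does, the two sides are disjoint. *)
Lemma side_marks_eq v u w t :
  adj E v u -> adj E w t -> side_marks v u = side_marks w t -> v = w.
Proof.
move=> vu wt eq_m; apply/eqP/negPn/negP => v_w.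
have strict (a b c d : vertex T) : adj E a b -> adj E c d -> a != c ->
    side_marks a b = side_marks c d -> c \in side E a b -> a \in side E c d.
  move=> ab cd ac eq_abcd cb; apply/negPn/negP => aNd.
  (* If [c] is internal, its branch [side c s] is neither the one towards [a] nor
     [side c d]. *)
  case: c => [x|i] in cd ac eq_abcd cb aNd *.
    have: x \in side_marks (inl x) d by rewrite -eq_abcd mem_side_marks.
    by rewrite side_marks_leaf // !inE eqxx.
  have [e ie ae] := side_exists treeE ac.
  have [s is_ /andP[se sd]] := internal_third i e d.
  have aNs : a \notin side E (inr i) s.
    by apply: contraNN se => /(side_unique treeE is_ ie)->.
  have /subsetP sub := side_marksS (side_nested_branch treeE is_ ab aNs cb).
  have /set0Pn[x xs] := side_marks_neq0 is_.
  have := sub x xs; rewrite eq_abcd => xd; rewrite !mem_side_marks in xs xd.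
  by rewrite (side_unique treeE is_ cd xs xd) eqxx in sd.
have w_v : w != v by rewrite eq_sym.
have [wu|wNu] := boolP (w \in side E v u).
  have vt := strict _ _ _ _ vu wt v_w eq_m wu.
  have tw : adj E t w by rewrite adj_sym.
  have vNw : v \notin side E t w by rewrite sideC // in_setC vt.
  have /set0Pn[x xw] := side_marks_neq0 tw.
  have /subsetP sub : side E t w \subset side E v u by apply: side_sub.
  have: x \in side_marks v u by rewrite mem_side_marks sub // -mem_side_marks.
  by rewrite eq_m; move: xw; rewrite side_marksC // in_setC => /negP.
have vNt : v \notin side E w t.
  by apply: contraNN wNu; apply: strict.
have [t' wt' vt'] := side_exists treeE v_w.
have /subsetP sub := side_marksS (side_nested_branch treeE vu wt' wNu vt').
have /set0Pn[x xu] := side_marks_neq0 vu.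
have := sub x xu; rewrite eq_m in xu; rewrite !mem_side_marks in xu * => xt'.
by rewrite -(side_unique treeE wt' wt xt' xu) vt' in vNt.
Qed.

Lemma vpart_block_inj v w B : B \in vpart v -> B \in vpart w -> v = w.
Proof.
rewrite !vpartE => /imsetP[u + ->] /imsetP[t]; rewrite !inE => vu wt.
exact: side_marks_eq.
Qed.

(** The two sides of an edge give opposite blocks, and since a block is found at
    only one vertex, opposite blocks occur only at the two ends of an edge. *)
Lemma adjP v w :
  reflect (exists2 B, B \in vpart v & ~: B \in vpart w) (adj E v w).
Proof.
apply: (iffP idP) => [vw|[B]].
  exists (side_marks v w); rewrite ?mem_vpart // -side_marksC // mem_vpart //.
  by rewrite adj_sym.
rewrite {1}vpartE => /imsetP[u]; rewrite inE => vu -> uw.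
have uv : adj E u v by rewrite adj_sym.
by rewrite (vpart_block_inj uw (w := u)) // -side_marksC // mem_vpart.
Qed.

Hypothesis X_ge3 : 3 <= #|X|.

Lemma neighbor_exists v : exists w, adj E v w.
Proof.
have : exists x, inl x != v.
  case: v => [x|i]; last first.
    by have /card_gt0P[x _] : 0 < #|X|; [apply: leq_trans X_ge3 | exists x].
  have /subsetPn[y _] : ~~ ([set: X] \subset [set x]).
    apply: contraL X_ge3 => /subset_leq_card.
    by rewrite cardsT cards1 -ltnNge => /leq_ltn_trans->.
  by rewrite inE => yx; exists y; apply: contraNneq yx => -[->].
by case=> x /(side_exists treeE)[w vw _]; exists w.
Qed.

Lemma vpart_leaf x : vpart (inl x : vertex T) = [set ~: [set x]].
Proof.
have [w xw] := neighbor_exists (inl x).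
rewrite vpartE -(side_marks_leaf xw); apply/setP => B; rewrite inE.
apply/imsetP/eqP => [[u]|->]; last by exists w; rewrite ?inE.
by rewrite inE => xu ->; rewrite (leaf_neighbors xw xu).
Qed.

Lemma vpart_inj : injective (@vpart X T).
Proof.
move=> v w eq_vw; have [u /mem_vpart vu] := neighbor_exists v.
by apply: (vpart_block_inj vu); rewrite -eq_vw.
Qed.

(** Two adjacent leaves would be the only vertices: the sides of their edge
    carry one mark each. *)
Lemma leaf_neighbor_internal x w : adj E (inl x) w -> exists i, w = inr i.
Proof.
case: w => [y|i xy]; last by exists i.
move=> xy; have yx : adj E (inl y) (inl x) by rewrite adj_sym.
suff: #|X| <= 2 by rewrite leqNgt X_ge3.
have := side_marksC xy; rewrite !side_marks_leaf // setCK => eq_yx.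
have x_y : ~: [set x] = [set y] by rewrite -eq_yx setCK.
by rewrite -cardsT -(setUCr [set x]) x_y cards2; case: (x == y).
Qed.

Lemma mem_psi i : vpart (inr i : vertex T) \in psi T.
Proof. by apply: imset_f; rewrite internalE. Qed.

Lemma psi_admissible : admissible (psi T).
Proof.
split.
- have /card_gt0P[x _] : 0 < #|X| by apply: leq_trans X_ge3.
  have [w /leaf_neighbor_internal[i _]] := neighbor_exists (inl x).
  by apply/set0Pn; exists (vpart (inr i)); exact: mem_psi.
- move=> P /imsetP[[x|i]]; rewrite internalE // => _ ->; exact: internal_partition.
- by move=> P /imsetP[v int_v ->]; rewrite card_vpart; apply: stable_mtree int_v.
- move=> P B /imsetP[v _ ->]; rewrite vpartE => /imsetP[w]; rewrite inE => vw ->.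
  have wv : adj E w v by rewrite adj_sym.
  case: w => [x|i] in vw wv *.
    by right; exists x; rewrite (side_marksC wv) side_marks_leaf ?setCK.
  left; exists (vpart (inr i)); first exact: mem_psi.
  by rewrite -side_marksC // mem_vpart.
move=> P1 P2 /imsetP[v _ ->] /imsetP[w _ ->] vw; apply: contraNeq vw.
by case/set0Pn=> B; rewrite inE => /andP[vB wB]; rewrite (vpart_block_inj vB wB).
Qed.

End Partitions.

(** * Isomorphisms *)

Section Isomorphisms.
Variables (X : finType).
Implicit Types T : mtree X.

(** A map that is injective and preserves adjacency sends each side into a side.
    As the sides at a vertex partition the other vertices, no inclusion can be
    strict, and no neighbour of [phi v] can be missed. *)
Lemma adj_morphism_vpart T T' (phi : vertex T -> vertex T') :
    bijective phi ->
    (forall v w, adj (edges T) v w -> adj (edges T') (phi v) (phi w)) ->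
    (forall x, phi (inl x) = inl x) ->
  forall v, vpart (phi v) = vpart v.
Proof.
case=> phi' phiK phi'K phi_adj phi_leaf v.
have phi_inj := can_inj phiK.
have treeT := is_tree_mtree T; have treeT' := is_tree_mtree T'.
have phi_side w u :
    u \in side (edges T) v w -> phi u \in side (edges T') (phi v) (phi w).
  rewrite inE => wu.
  apply: (connect_closed_ind
            (P := fun z => phi z \in side (edges T') (phi v) (phi w)) _ _ wu).
    exact: side_refl.
  move=> a b wa /and3P[av bv ab].
  by apply: (side_step wa); rewrite ?(inj_eq phi_inj) ?phi_adj.
have phi_marks w : adj (edges T) v w -> side_marks (phi v) (phi w) = side_marks v w.
  move=> vw; apply/setP => x; rewrite !mem_side_marks; apply/idP/idP => [wx|/phi_side].
    have xv : inl x != v.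
      apply: contraTneq wx => xv; have -> : inl x = phi v by rewrite -xv phi_leaf.
      by rewrite side_notin // eq_sym (adj_neq treeT' (phi_adj _ _ vw)).
    have [u vu ux] := side_exists treeT xv.
    have := phi_side _ _ ux; rewrite phi_leaf => ux'.
    have /phi_inj-> // := side_unique treeT' (phi_adj _ _ vw) (phi_adj _ _ vu) wx ux'.
  by rewrite phi_leaf.
rewrite !vpartE; apply/setP => B; apply/imsetP/imsetP => -[w]; rewrite inE => vw ->.
  have wv : phi' w != v.
    apply: contraTneq vw => <-; rewrite phi'K; apply/negP => /(adj_neq treeT').
    by rewrite eqxx.
  have [u vu uw] := side_exists treeT wv; exists u; first by rewrite inE.
  have := phi_side _ _ uw; rewrite phi'K -phi_marks // => uw'.
  by rewrite (side_unique treeT' vw (phi_adj _ _ vu) (side_refl _ _ _) uw').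
by exists (phi w); rewrite ?phi_marks // inE phi_adj.
Qed.

(** Leaves and internal vertices are all the vertices, so a bijective tree map
    restricts to a bijection between the vertices; only this restriction
    matters for [psi]. *)
Lemma isomorphic_psi T T' : isomorphic T T' -> psi T = psi T'.
Proof.
case=> f [[f_int f_leaf f_edge f_adj] [g fK gK] f_id].
have f_vertex v : exists v', f (inl v) == inl v'.
  have [/f_leaf[v' _ ->]|Nv] := boolP (v \in leaves (edges T)); first by exists v'.
  by have [|v' _ ->] := f_int v; [rewrite inE | exists v'].
pose phi v := xchoose (f_vertex v).
have phiE v : f (inl v) = inl (phi v) by apply/eqP/(xchooseP (f_vertex v)).
have g_vertex v' : exists v, g (inl v') == inl v.
  case g_v': (g (inl v')) => [v|e]; first by exists v.
  by have [e' fe] := f_edge e; have := gK (inl v'); rewrite g_v' fe.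
pose phi' v := xchoose (g_vertex v).
have phi'E v : g (inl v) = inl (phi' v) by apply/eqP/(xchooseP (g_vertex v)).
have phi_bij : bijective phi.
  exists phi' => v.
    by have := fK (inl v); rewrite phiE phi'E => -[].
  by have := gK (inl v); rewrite phi'E phiE => -[].
have phi_leaf x : phi (inl x) = inl x by have := f_id x; rewrite phiE => -[].
have phi_adj v w : adj (edges T) v w -> adj (edges T') (phi v) (phi w).
  by case/f_adj=> v' [w' []]; rewrite !phiE => -[->] [->].
have phi_int v : (phi v \in internal (edges T')) = (v \in internal (edges T)).
  rewrite !internalE; case: v => [x|i]; first by rewrite phi_leaf.
  case phi_i: (phi (inr i)) => [x|//]; rewrite -phi_leaf in phi_i.
  by have := bij_inj phi_bij phi_i.
have vpart_phi := adj_morphism_vpart phi_bij phi_adj phi_leaf.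
have [phi1 phiK phi1K] := phi_bij.
apply/setP => P; apply/imsetP/imsetP => -[v int_v ->].
  by exists (phi v); rewrite ?phi_int.
by exists (phi1 v); rewrite -1?vpart_phi ?phi1K // -phi_int phi1K.
Qed.

Hypothesis X_ge3 : 3 <= #|X|.

Lemma psi_vertex T T' : psi T = psi T' ->
  exists phi : vertex T -> vertex T', forall v, vpart (phi v) = vpart v.
Proof.
move=> eq_psi.
have phi_ex (v : vertex T) : exists v' : vertex T', vpart v' == vpart v.
  case: v => [x|i].
    by exists (inl x); rewrite !vpart_leaf.
  by have := mem_psi i; rewrite eq_psi => /imsetP[v' _ ->]; exists v'.
by exists (fun v => xchoose (phi_ex v)) => v; apply/eqP/(xchooseP (phi_ex v)).
Qed.

(** The vertex map and its inverse are characterized by the preservation of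
    [vpart], so injectivity of [vpart] makes them mutually inverse and the
    identity on leaves; [adjP] makes them preserve adjacency. *)
Lemma psi_isomorphic T T' : psi T = psi T' -> isomorphic T T'.
Proof.
move=> eq_psi; have [phi vpart_phi] := psi_vertex eq_psi.
have [phi' vpart_phi'] := psi_vertex (esym eq_psi).
have phiK : cancel phi phi'.
  by move=> v; apply: (vpart_inj X_ge3); rewrite vpart_phi' vpart_phi.
have phi'K : cancel phi' phi.
  by move=> v; apply: (vpart_inj X_ge3); rewrite vpart_phi vpart_phi'.
have phi_leaf x : phi (inl x) = inl x.
  by apply: (vpart_inj X_ge3); rewrite vpart_phi !vpart_leaf.
have phi_adj v w : adj (edges T') (phi v) (phi w) = adj (edges T) v w.
  by apply/adjP/adjP; rewrite !vpart_phi.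
have phi'_adj v w : adj (edges T) (phi' v) (phi' w) = adj (edges T') v w.
  by rewrite -phi_adj !phi'K.
have edge_set2 (S : mtree X) (e : edge S) : exists v w, val e = [set v; w].
  have treeS := is_tree_mtree S; have [card_e _ _] := treeS.
  have /card_gt0P[v ve] : 0 < #|val e| by rewrite card_e ?(valP e).
  by have [w e_vw] := edge_other treeS (valP e) ve; exists v, w.
have phi_edge (e : edge T) : phi @: val e \in edges T'.
  have [v [w e_vw]] := edge_set2 _ e; have := valP e.
  by rewrite e_vw imsetU1 imset_set1; have := phi_adj v w; rewrite /adj /= => ->.
have phi'_edge (e : edge T') : phi' @: val e \in edges T.
  have [v [w e_vw]] := edge_set2 _ e; have := valP e.
  by rewrite e_vw imsetU1 imset_set1; have := phi'_adj v w; rewrite /adj /= => ->.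
pose f (z : elt T) : elt T' := match z with
  | inl v => inl (phi v)
  | inr e => inr (exist (fun e => e \in edges T') _ (phi_edge e))
  end.
pose g (z : elt T') : elt T := match z with
  | inl v => inl (phi' v)
  | inr e => inr (exist (fun e => e \in edges T) _ (phi'_edge e))
  end.
have phi_int v : (phi v \in internal (edges T')) = (v \in internal (edges T)).
  rewrite !internalE; case: v => [x|i]; first by rewrite phi_leaf.
  case phi_i: (phi (inr i)) => [x|//]; rewrite -phi_leaf in phi_i.
  by have := can_inj phiK phi_i.
exists f; split; last by move=> x; rewrite /= phi_leaf.
- split.
  + by move=> v int_v; exists (phi v); rewrite ?phi_int.
  + move=> v leaf_v; exists (phi v) => //.
    by move: (phi_int v); rewrite !in_setC leaf_v => /negbFE.
  + by move=> e; eexists.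
  + by move=> v w vw; exists (phi v), (phi w); rewrite phi_adj.
exists g => [] [v|e] /=; rewrite ?phiK ?phi'K //; congr inr; apply: val_inj => /=.
  by rewrite -imset_comp (eq_imset _ phiK) imset_id.
by rewrite -imset_comp (eq_imset _ phi'K) imset_id.
Qed.

End Isomorphisms.

(** * Realizing an admissible collection *)

Section Realization.
Variables (X : finType) (C : {set {set {set X}}}).
Hypothesis C_neq0 : C != set0.
Hypothesis C_partition : forall P, P \in C -> partition P [set: X].
Hypothesis C_ge3 : forall P, P \in C -> 3 <= #|P|.
Hypothesis C_opposite : forall P B, P \in C -> B \in P ->
  (exists2 P', P' \in C & ~: B \in P') \/ (exists x, B = [set x]).
Hypothesis C_disjoint :
  forall P1 P2, P1 \in C -> P2 \in C -> P1 != P2 -> P1 :&: P2 = set0.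

Definition node : finType := {P : {set {set X}} | P \in C}.

(** The partition found at each vertex of the tree to be built. A leaf has a single
    side, which contains all the other marks. *)
Definition blocks (v : X + node) : {set {set X}} :=
  match v with inl x => [set ~: [set x]] | inr P => val P end.

Definition linked (v w : X + node) : bool :=
  [exists B, (B \in blocks v) && (~: B \in blocks w)].

Definition links : {set {set (X + node)}} :=
  [set [set p.1; p.2] | p in [set p | linked p.1 p.2]].

Lemma linkedP v w :
  reflect (exists2 B, B \in blocks v & ~: B \in blocks w) (linked v w).
Proof.
by apply: (iffP existsP) => -[B]; [case/andP|]; exists B => //; apply/andP.
Qed.

Lemma linked_sym : symmetric linked.
Proof.
suff sub v w : linked v w -> linked w v by move=> v w; apply/idP/idP; apply: sub.
by case/linkedP=> B vB wB; apply/linkedP; exists (~: B); rewrite ?setCK.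
Qed.

Lemma adj_links v w : adj links v w = linked v w.
Proof.
apply/imsetP/idP => [[[a b]]|vw]; last by exists (v, w); rewrite ?inE.
rewrite inE /= => ab eq_vw.
have: v \in [set a; b] by rewrite -eq_vw set21.
rewrite in_set2 => /orP[]/eqP v_a; rewrite v_a in eq_vw *.
  by move/set2_inj: eq_vw => ->.
by rewrite (setUC [set a]) in eq_vw; move/set2_inj: eq_vw => ->; rewrite linked_sym.
Qed.

Lemma blocks_trivIset v : trivIset (blocks v).
Proof.
case: v => [x|[P /= PC]]; last by have /and3P[] := C_partition PC.
by apply/trivIsetP => A B; rewrite !inE => /eqP-> /eqP->; rewrite eqxx.
Qed.

Lemma blocks_eq v A B x :
  A \in blocks v -> B \in blocks v -> x \in A -> x \in B -> A = B.
Proof.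
move=> vA vB xA xB.
by rewrite -(def_pblock (blocks_trivIset v) vA xA)
  (def_pblock (blocks_trivIset v) vB xB).
Qed.

Lemma cover_blocks v x : v != inl x -> x \in cover (blocks v).
Proof.
case: v => [y yx|[P /= PC] _].
  rewrite /= /cover big_set1 in_setC in_set1; apply: contraNneq yx => ->; exact: eqxx.
by have /and3P[/eqP-> _ _] := C_partition PC; rewrite inE.
Qed.

Lemma block_at v x : v != inl x -> exists2 B, B \in blocks v & x \in B.
Proof. by move/cover_blocks/bigcupP=> [B vB xB]; exists B. Qed.

(** A partition containing a set and its complement has no third block. *)
Lemma blocks_compl v B : B \in blocks v -> ~: B \notin blocks v.
Proof.
case: v => [x|[P PC]].
  by rewrite !inE => /eqP->; apply/eqP => /setP/(_ x); rewrite !inE eqxx.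
move=> PB; apply/negP => PnB; have := C_ge3 PC; rewrite ltnNge => /negP[].
apply: (@leq_trans #|[set B; ~: B]|); last by rewrite cards2; case: (_ == _).
apply: subset_leq_card; apply/subsetP => A PA; rewrite in_set2.
have /set0Pn[x xA] : A != set0.
  by have /and3P[_ _ N0] := C_partition PC; apply: contraTneq PA => ->.
have [xB|xNB] := boolP (x \in B).
  by rewrite (@blocks_eq (inr (exist _ P PC)) A B x) ?eqxx.
by rewrite (@blocks_eq (inr (exist _ P PC)) A (~: B) x) ?eqxx ?orbT // inE.
Qed.

Lemma blocks_proper v D A x :
  D \in blocks v -> A \in blocks v -> x \in A -> x \notin D -> A \proper ~: D.
Proof.
move=> vD vA xA xND.
have AD : A != ~: D by apply: contraTneq vA => ->; apply: blocks_compl.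
rewrite properEneq AD; apply/subsetP => y yA; rewrite in_setC.
by apply: contraNN xND => yD; rewrite -(blocks_eq vA vD yA yD).
Qed.

Lemma blocks_inj v w B : B \in blocks v -> B \in blocks w -> v = w.
Proof.
have leaf_node x (Q : node) : ~: [set x] \notin blocks (inr Q).
  apply/negP => QB; have [|A QA xA] := @block_at (inr Q) x; first by [].
  have := blocks_proper QB QA xA; rewrite setCK !inE eqxx => /(_ isT).
  by rewrite properE => /andP[_]; rewrite sub1set xA.
case: v w => [x|P] [y|Q].
- by rewrite !inE => /eqP-> /eqP/setC_inj/set1_inj->.
- by rewrite inE => /eqP-> QB; have := leaf_node x Q; rewrite QB.
- by move=> QB; rewrite inE => /eqP eqB; have := leaf_node y P; rewrite -eqB QB.
move=> PB QB; congr inr; apply: val_inj; apply/eqP/negPn/negP => PQ.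
by have /setP/(_ B) := C_disjoint (valP P) (valP Q) PQ; rewrite !inE PB QB.
Qed.

(** Following opposite blocks towards [x], the block containing [x] shrinks
    until it is a singleton. *)
Lemma singleton_block x : exists Q : node, [set x] \in blocks (inr Q).
Proof.
have descent n (P : node) B : B \in blocks (inr P) -> x \in B -> #|B| < n ->
    exists Q : node, [set x] \in blocks (inr Q).
  elim: n P B => // n IHn P B PB xB; rewrite ltnS => le_n.
  have [[P' P'C P'B]|[y By]] := C_opposite (valP P) PB; last first.
    by exists P; move: xB PB; rewrite By inE => /eqP->.
  pose Q : node := exist (fun P => P \in C) P' P'C.
  have [|A QA xA] := @block_at (inr Q) x; first by [].
  apply: (IHn Q A) => //; apply: leq_trans le_n; apply: proper_card.
  by rewrite -[B]setCK; apply: (@blocks_proper (inr Q) _ _ x); rewrite ?inE ?xB.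
have /set0Pn[P PC] := C_neq0; pose P0 : node := exist (fun P => P \in C) P PC.
by have [|B PB xB] := @block_at (inr P0) x; last exact: (descent #|B|.+1 P0 B).
Qed.

Lemma opposite_exists v B : B \in blocks v -> exists w, ~: B \in blocks w.
Proof.
case: v => [x|P] vB.
  have [Q Qx] := singleton_block x; exists (inr Q).
  by move: vB; rewrite inE => /eqP->; rewrite setCK.
have [[P' P'C P'B]|[y By]] := C_opposite (valP P) vB.
  by exists (inr (exist (fun P => P \in C) P' P'C)).
by exists (inl y); rewrite By inE.
Qed.

(** Two vertices are linked through at most one pair of opposite blocks:
    otherwise the two blocks at [v] would be disjoint and so would their
    complements, hence the blocks would be opposite to each other. *)
Lemma opposite_inj v w A B : A \in blocks v -> B \in blocks v ->
  ~: A \in blocks w -> ~: B \in blocks w -> A = B.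
Proof.
move=> vA vB wA wB; apply/eqP/negPn/negP => A_B.
have BA : B = ~: A.
  apply/setP => x; rewrite inE; apply/idP/idP => [xB|xNA].
    by apply: contraNN A_B => xA; rewrite (blocks_eq vA vB xA xB).
  apply: contraNT A_B => xNB; rewrite -(inj_eq (@setC_inj _)).
  by rewrite (blocks_eq wA wB (x := x)) ?inE.
rewrite -BA in wA; have vw := blocks_inj vB wA; rewrite -vw in wB.
by have := blocks_compl vB; rewrite wB.
Qed.

Section Rooted.
Variable x0 : X.

(** A height above the leaf [x0]. The vertex [x0] itself has no block containing
    [x0], so its rank is [#|set0| = 0]. *)
Definition rank v : nat := #|pblock (blocks v) x0|.

Lemma rank_lt v w B :
  B \in blocks v -> ~: B \in blocks w -> x0 \in B -> rank w < rank v.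
Proof.
move=> vB wB x0B; rewrite /rank (def_pblock (blocks_trivIset v) vB x0B).
apply: proper_card; have [x0w|x0Nw] := boolP (x0 \in cover (blocks w)).
  rewrite -[B]setCK.
  by rewrite (blocks_proper (x := x0) wB (pblock_mem x0w)) ?mem_pblock // inE x0B.
have -> : pblock (blocks w) x0 = set0.
  rewrite /pblock; case: pickP => //= D /andP[wD x0D].
  by case/negP: x0Nw; apply/bigcupP; exists D.
by rewrite proper0; apply/set0Pn; exists x0.
Qed.

(** A link that does not go up in rank leads to the parent, that is to the
    vertex owning the opposite of the block that contains [x0]. *)
Lemma linked_parent v w :
  linked v w -> rank w <= rank v -> ~: pblock (blocks v) x0 \in blocks w.
Proof.
case/linkedP=> B vB wB le_wv; have [x0B|x0NB] := boolP (x0 \in B).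
  by rewrite (def_pblock (blocks_trivIset v) vB x0B).
have := rank_lt (v := w) (w := v) wB; rewrite setCK inE x0NB => /(_ vB isT).
by rewrite ltnNge le_wv.
Qed.

Lemma linked_connected v : connect (adj links) v (inl x0).
Proof.
have [n] := ubnP (rank v); elim: n v => // n IHn v; rewrite ltnS => le_n.
have [->|v_x0] := eqVneq v (inl x0); first exact: connect0.
have [B vB x0B] := block_at v_x0; have [w wB] := opposite_exists vB.
apply: connect_trans (IHn w _); last by apply: leq_trans le_n; apply: rank_lt wB x0B.
by apply: connect1; rewrite adj_links; apply/linkedP; exists B.
Qed.

(** A vertex of maximal rank on a cycle has its parent as both neighbours. *)
Lemma linked_acyclic c : ucycle (adj links) c -> size c <= 2.
Proof.
case: c => // v0 c0; set c := v0 :: c0 => cyc_c.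
have v0c : v0 \in c by rewrite mem_head.
case: (@arg_maxnP _ v0 [in c] rank v0c) => v vc max_v.
have [i p def_p] := rot_to vc; rewrite -(size_rot i) def_p.
have sub_p w : w \in v :: p -> rank w <= rank v.
  by rewrite -def_p mem_rot; apply: max_v.
have : ucycle (adj links) (v :: p) by rewrite -def_p rot_ucycle.
case: p {def_p} sub_p => [|a [|b p]] // sub_p /andP[/= /andP[va /andP[_]]].
rewrite rcons_path => /andP[_ lv] /and3P[_ aNp _]; exfalso.
have l_p : last b p \in b :: p by apply: mem_last.
rewrite adj_sym in lv; rewrite !adj_links in va lv.
have par_a := linked_parent va (sub_p _ _); have par_l := linked_parent lv (sub_p _ _).
move: aNp; rewrite (blocks_inj (par_a _) (par_l _)) ?l_p //.
  by rewrite !in_cons eqxx orbT.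
by rewrite !(in_cons v) (in_cons a) l_p !orbT.
Qed.

Lemma links_tree : is_tree links.
Proof.
split; last exact: linked_acyclic.
- move=> e /imsetP[[v w]]; rewrite inE /= => /linkedP[B vB wB] ->.
  rewrite cards2; have [vw|//] := eqVneq v w.
  by have := blocks_compl vB; rewrite vw wB.
- move=> v w; apply: connect_trans (linked_connected v) _.
  by rewrite sym_connect_sym ?linked_connected //; apply: adj_sym.
Qed.

Lemma valence_links v : valence links v = #|blocks v|.
Proof.
rewrite (valence_neighbors links_tree).
pose opp B := odflt v [pick w | ~: B \in blocks w].
have oppP B : B \in blocks v -> ~: B \in blocks (opp B).
  move=> vB; rewrite /opp; case: pickP => [//|none].
  by have [w wB] := opposite_exists vB; rewrite none in wB.
rewrite -(card_in_imset (f := opp)) => [|A B vA vB eqAB].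
  apply: eq_card => w; rewrite inE adj_links; apply/linkedP/imsetP => -[B vB].
    by move=> wB; exists B => //; apply: blocks_inj wB (oppP _ vB).
  by move=> ->; exists B; rewrite ?oppP.
by apply: (opposite_inj vA vB (oppP _ vA)); rewrite eqAB oppP.
Qed.

Lemma leaves_links : leaves links = [set inl x | x : X].
Proof.
apply/setP => -[x|P]; rewrite inE valence_links.
  by rewrite cards1 eqxx imset_f.
rewrite (_ : _ == 1 = false); first by apply/esym/imsetP => -[].
by apply/eqP => P1; have := C_ge3 (valP P); rewrite /= in P1; rewrite P1.
Qed.

Lemma links_stable v : v \in internal links -> 3 <= valence links v.
Proof.
rewrite inE leaves_links valence_links; case: v => [x|P _].
  by rewrite imset_f.
exact: (C_ge3 (valP P)).
Qed.

Definition realization : mtree X := MTree links_tree leaves_links links_stable.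

(** From a mark [x] of [B], step across the link into [w], where the block
    containing [x] is strictly smaller, and continue until the leaf [x]. *)
Lemma block_sub_side (v w : vertex realization) B :
  B \in blocks v -> ~: B \in blocks w -> B \subset side_marks v w.
Proof.
have [n] := ubnP #|B|; elim: n v w B => // n IHn v w B; rewrite ltnS => le_n vB wB.
apply/subsetP => x xB; case: w => [y|Q] in wB *.
  move: wB xB; rewrite inE => /eqP/setC_inj->; rewrite inE => /eqP->.
  by rewrite mem_side_marks side_refl.
have [|A QA xA] := @block_at (inr Q) x; first by [].
have AB : A \proper B.
  by rewrite -[B]setCK (blocks_proper (x := x) wB QA) // inE xB.
have [u uA] := opposite_exists QA.
have vQ : adj links v (inr Q) by rewrite adj_links; apply/linkedP; exists B.
have Qu : adj links (inr Q) u by rewrite adj_links; apply/linkedP; exists A.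
have uv : u != v.
  apply: contraTneq xA => u_v; rewrite u_v in uA.
  by rewrite -(opposite_inj (w := v) wB QA) ?setCK // inE xB.
have := side_marksS (T := realization) (side_nested links_tree vQ Qu uv).
move/subsetP; apply; apply: (subsetP (IHn (inr Q) u A _ QA uA)) => //.
by apply: leq_trans le_n; apply: proper_card.
Qed.

(** The blocks of [P] and the sides at [P] are both partitions of [X], matched by
    an inclusion, so they agree. *)
Lemma vpart_realization (P : node) :
  vpart (inr P : vertex realization) = val P.
Proof.
have side_block w B : B \in val P -> ~: B \in blocks w ->
    side_marks (inr P : vertex realization) w = B.
  move=> PB wB; apply/eqP; rewrite eqEsubset block_sub_side // andbT.
  have link u A : A \in val P -> ~: A \in blocks u -> adj links (inr P) u.
    by move=> PA uA; rewrite adj_links; apply/linkedP; exists A.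
  apply/subsetP => x xw; have [|A PA xA] := @block_at (inr P) x; first by [].
  have [u uA] := opposite_exists PA.
  have /subsetP/(_ x xA) xu := block_sub_side (v := inr P) PA uA.
  rewrite !mem_side_marks in xw xu.
  have wu := side_unique links_tree (link _ _ PB wB) (link _ _ PA uA) xw xu.
  by rewrite -(opposite_inj (v := inr P) PA PB uA) // -wu.
apply/setP => B; rewrite vpartE; apply/imsetP/idP => [[w]|PB].
  by rewrite inE adj_links => /linkedP[A PA wA] ->; rewrite (side_block w A).
have [w wB] := opposite_exists (v := inr P) PB.
exists w; last by rewrite (side_block w B).
by rewrite inE adj_links; apply/linkedP; exists B.
Qed.

Lemma psi_realization : psi realization = C.
Proof.
apply/setP => P; apply/imsetP/idP => [[[x|Q]]|PC].
- by rewrite internalE.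
- by rewrite vpart_realization => _ ->; apply: valP.
by exists (inr (exist (fun P => P \in C) P PC)); rewrite ?internalE ?vpart_realization.
Qed.

End Rooted.

End Realization.

Theorem theorem2p6 (X : finType) (X_ge3 : 3 <= #|X|) :
  [/\ forall T T' : mtree X, isomorphic T T' <-> psi T = psi T',
      forall T : mtree X, admissible (psi T)
    & forall C : {set {set {set X}}}, admissible C ->
        exists T : mtree X, psi T = C].
Proof.
split=> [T T'|T|C [C0 C_part C_ge3 C_opp C_disj]].
- by split; [apply: isomorphic_psi | apply: psi_isomorphic].
- exact: psi_admissible.
have /card_gt0P[x0 _] : 0 < #|X| by apply: leq_trans X_ge3.
by exists (realization C0 C_part C_ge3 C_opp C_disj x0); apply: psi_realization.
Qed.
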